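(* Let $X$ be an Hadamard space with linear dual space $X^{\lozenge}$. The following statements are equivalent: (i) $X$ is a flat Hadamard space. (ii) $\langle \overrightarrow{x((1-\lambda)x\oplus \lambda y)},\overrightarrow{ab} \rangle=\lambda \langle \overrightarrow{xy},\overrightarrow{ab} \rangle$ for all $a,b,x,y\in X$ and all $\lambda\in[0,1]$. (iii) $X\times X^{\lozenge}$ has the $\mathcal{W}$-property. (iv) Every subset of $X\times X^{\lozenge}$ has the $\mathcal{W}$-property. (v) For each $p,z \in X$, the mapping $\varphi_{\overrightarrow{pz}}$ is convex, i.e. $\varphi_{\overrightarrow{pz}}((1-\lambda)x\oplus \lambda y)\le(1-\lambda)\varphi_{\overrightarrow{pz}}(x)+\lambda\varphi_{\overrightarrow{pz}}(y)$ for all $x,y\in X$ and $\lambda\in[0,1]$. (vi) For each $p,z \in X$, the mapping $\varphi_{\overrightarrow{pz}}$ is affine, in the sense that $\varphi_{\overrightarrow{pz}}((1-\lambda)x\oplus \lambda y)=(1-\lambda)\varphi_{\overrightarrow{pz}}(x)+\lambda\varphi_{\overrightarrow{pz}}(y)$ for all $x, y\in X$ and $\lambda\in[0,1]$.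
   Context: A geodesic path from $x$ to $y$ in a metric space $(X,d)$ is a map $c:[0,1]\to X$ with $c(0)=x$, $c(1)=y$ and $d(c(t),c(s))=|t-s|d(x,y)$ for all $t,s$. A geodesic space is a metric space in which any two points are joined by a geodesic path. An Hadamard space is a complete (nonempty) CAT(0) space, i.e. a complete geodesic space satisfying the CN-inequality $d(z,(1-\lambda)x\oplus \lambda y)^2 \leq (1-\lambda)d(z,x)^2 +\lambda d(z,y)^2-\lambda(1-\lambda)d(x,y)^2$ for all $x,y,z\in X$, $\lambda\in[0,1]$. In such a space geodesics are unique, and $(1-\lambda)x\oplus\lambda y$ denotes $c(\lambda)$ for the geodesic path $c$ from $x$ to $y$. An Hadamard space is flat if equality holds in the CN-inequality for all $x,y,z\in X$ and $\lambda\in[0,1]$. Bound vectors: $\overrightarrow{xy}$ denotes the ordered pair $(x,y)\in X^2$. The quasilinearization map is $\langle \overrightarrow{ab}, \overrightarrow{cd} \rangle=\frac12\{d(a,d)^2+d(b,c)^2-d(a,c)^2-d(b,d)^2\}$ for $a,b,c,d\in X$. For $p,z\in X$, $\varphi_{\overrightarrow{pz}}:X\to\mathbb{R}$ is $\varphi_{\overrightarrow{pz}}(u)=\frac12(d(p,u)^2-d(z,u)^2)$. Dual spaces: for $t\in\mathbb{R}$ and $a,b\in X$, $[t\overrightarrow{ab}]$ denotes the class of $(t,a,b)$ under the relation $(t,a,b)\sim(s,c,d)$ iff $t\langle\overrightarrow{ab},\overrightarrow{xy}\rangle=s\langle\overrightarrow{cd},\overrightarrow{xy}\rangle$ for all $x,y\in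 X$; it acts on $X^2$ by $\langle[t\overrightarrow{ab}],\overrightarrow{xy}\rangle=t\langle\overrightarrow{ab},\overrightarrow{xy}\rangle$. $X^*$ is the set of all these classes, viewed as real functions on $X^2$. The linear dual space is $X^{\lozenge}=\operatorname{span}X^*=\{\sum_{i=1}^n\alpha_i x_i^*:\alpha_i\in\mathbb{R},x_i^*\in X^*,n\in\mathbb{N}\}$, acting by $\langle\sum_i\alpha_ix_i^*,\overrightarrow{xy}\rangle=\sum_i\alpha_i\langle x_i^*,\overrightarrow{xy}\rangle$; elements are identified when they agree as functions on $X^2$. For $M\subseteq X\times X^{\lozenge}$, $\mathrm{Dom}(M)=\{x:\exists x^{\lozenge},(x,x^{\lozenge})\in M\}$ and $\mathrm{Range}(M)=\{x^{\lozenge}:\exists x,(x,x^{\lozenge})\in M\}$. $M$ has (satisfies) the $\mathcal{W}$-property if there exists $p\in X$ such that $\langle x^{\lozenge},\overrightarrow{p((1-\lambda)x_1\oplus \lambda x_2)}\rangle \leq(1-\lambda) \langle x^{\lozenge},\overrightarrow{px_1}\rangle +\lambda \langle x^{\lozenge},\overrightarrow{px_2} \rangle$ for all $\lambda \in [0,1]$, all $x^{\lozenge} \in\mathrm{Range}(M)$ and all $x_1,x_2 \in\mathrm{Dom}(M)$. *)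

(* Defs.v *)
From HB Require Import structures.
From mathcomp Require Import all_boot all_order all_algebra ring lra.
From mathcomp Require Import all_classical all_reals all_analysis.

Set Implicit Arguments.
Unset Strict Implicit.
Unset Printing Implicit Defensive.

Import Order.TTheory GRing.Theory Num.Theory.
Local Open Scope classical_set_scope.
Local Open Scope ring_scope.

(* [Complete] includes a base point, so these spaces are nonempty. *)
#[short(type="completeMetricType")]
HB.structure Definition CompleteMetric (R : numDomainType) :=
  {M of Metric R M & Complete M}.

Section Hadamard.
Context {R : realType} {X : completeMetricType R}.
Implicit Types (a b c d x y z p u : X) (lam t s : R).

Local Notation dist := (@mdist R X).

(* A path [0,1] -> X is represented by a total function R -> X, whose values
   outside [0,1] are irrelevant. *)
Definition geodesic_path x y (g : R -> X) : Prop :=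
  [/\ g 0 = x, g 1 = y &
      forall t s, 0 <= t <= 1 -> 0 <= s <= 1 ->
        dist (g t) (g s) = `|t - s| * dist x y].

Definition geodesic_space : Prop := forall x y, exists g, geodesic_path x y g.

(* Geodesics are not yet known to be unique when CAT(0) is defined, hence the
   quantification over all of them. *)
Definition CN_inequality : Prop :=
  forall x y (g : R -> X), geodesic_path x y g ->
  forall z lam, 0 <= lam <= 1 ->
    dist z (g lam) ^+ 2 <=
      (1 - lam) * dist z x ^+ 2 + lam * dist z y ^+ 2
      - lam * (1 - lam) * dist x y ^+ 2.

Definition hadamard : Prop := geodesic_space /\ CN_inequality.

(* The geodesic path from x to y (constant if there is none). *)
Definition geodesic x y : R -> X := xget (cst x) [set g | geodesic_path x y g].

(* (1 - lam) x (+) lam y, meaningful for lam in [0,1] *)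
Definition oplus lam x y : X := geodesic x y lam.

Lemma geodesicP : geodesic_space -> forall x y, geodesic_path x y (geodesic x y).
Proof. by move=> gX x y; have [g gxy] := gX x y; exact: (xgetI (cst x) gxy). Qed.

Lemma geodesic_unique : CN_inequality -> forall x y (g h : R -> X),
  geodesic_path x y g -> geodesic_path x y h ->
  forall lam, 0 <= lam <= 1 -> g lam = h lam.
Proof.
move=> cn x y g h gxy [h0 h1 hd] lam lam01.
have := cn x y g gxy (h lam) lam lam01.
have /andP[l0 l1] := lam01.
rewrite -{1}h0 -{1}h1 !hd ?lexx ?ler01//.
rewrite subr0 ger0_norm// ler0_norm ?subr_le0//.
move=> le0; apply/esym/(@mdist_positivity R); apply/eqP.
rewrite -sqrf_eq0 eq_le sqr_ge0 andbT; apply: (le_trans le0).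
by rewrite le_eqVlt; apply/orP; left; apply/eqP; ring.
Qed.

Lemma oplusE : hadamard -> forall x y (g : R -> X), geodesic_path x y g ->
  forall lam, 0 <= lam <= 1 -> oplus lam x y = g lam.
Proof.
by move=> [gX cn] x y g gxy; exact: (geodesic_unique cn (geodesicP gX x y) gxy).
Qed.

Definition flat_hadamard : Prop :=
  hadamard /\
  forall x y z lam, 0 <= lam <= 1 ->
    dist z (oplus lam x y) ^+ 2 =
      (1 - lam) * dist z x ^+ 2 + lam * dist z y ^+ 2
      - lam * (1 - lam) * dist x y ^+ 2.

(* The bound vector from a to b is the pair (a, b). *)
Definition quasilin (ab cd : X * X) : R :=
  2^-1 * (dist ab.1 cd.2 ^+ 2 + dist ab.2 cd.1 ^+ 2
          - dist ab.1 cd.1 ^+ 2 - dist ab.2 cd.2 ^+ 2).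

Definition phi p z u : R := 2^-1 * (dist p u ^+ 2 - dist z u ^+ 2).

Definition geo_convex (f : X -> R) : Prop :=
  forall x y lam, 0 <= lam <= 1 ->
    f (oplus lam x y) <= (1 - lam) * f x + lam * f y.

Definition geo_affine (f : X -> R) : Prop :=
  forall x y lam, 0 <= lam <= 1 ->
    f (oplus lam x y) = (1 - lam) * f x + lam * f y.

(* (t, ab) ~ (s, cd) *)
Definition dual_equiv (t : R) (ab : X * X) (s : R) (cd : X * X) : Prop :=
  forall xy, t * quasilin ab xy = s * quasilin cd xy.

(* The class [t ab], identified with its action on X^2. *)
Definition dual_class (t : R) (ab : X * X) : X * X -> R :=
  fun xy => t * quasilin ab xy.

Lemma dual_class_eq t ab s cd :
  dual_class t ab = dual_class s cd <-> dual_equiv t ab s cd.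
Proof. by split=> [e xy|e]; [exact: (congr1 (@^~ xy) e)|exact/funext]. Qed.

Definition dual : set (X * X -> R) := [set f | exists t ab, f = dual_class t ab].

Definition linear_dual : set (X * X -> R) :=
  [set f | exists (n : nat) (alpha : 'I_n -> R) (xs : 'I_n -> X * X -> R),
     (forall i, dual (xs i)) /\
     f = (fun xy => \sum_(i < n) alpha i * xs i xy)].

(* M.`1 and M.`2 are the domain and the range of the relation M. *)
Definition W_property (M : set (X * (X * X -> R))) : Prop :=
  exists p, forall lam, 0 <= lam <= 1 ->
    forall xl, M.`2 xl -> forall x1 x2, M.`1 x1 -> M.`1 x2 ->
      xl (p, oplus lam x1 x2) <= (1 - lam) * xl (p, x1) + lam * xl (p, x2).

End Hadamard.

Arguments hadamard {R} X.
Arguments flat_hadamard {R} X.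
Arguments linear_dual {R} X.

(* Main.v *)
Require Import Defs.
From mathcomp Require Import all_boot all_order all_algebra ring lra.
From mathcomp Require Import all_classical all_reals all_analysis.

Import Order.TTheory GRing.Theory Num.Theory.
Local Open Scope classical_set_scope.
Local Open Scope ring_scope.

(** Up to an additive constant, [phi p z] is the functional
    [u |-> <pz, qu>], whatever the base point [q]; since it is antisymmetric in
    [(p, z)], convexity of all of them forces affinity. Conversely, affinity of
    [phi p x] along the geodesic from [x] to [y], where the distance to [x] is
    known, is equality in the CN-inequality at [p]. *)

Section Quasilinearization.
Context {R : realType} {X : completeMetricType R}.
Implicit Types (a b c d p q u x y z : X) (lam : R).

Lemma quasilinC (ab cd : X * X) : quasilin ab cd = quasilin cd ab.
Proof.
rewrite /quasilin (metric_sym ab.1 cd.2) (metric_sym ab.2 cd.1).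
by rewrite (metric_sym ab.1 cd.1) (metric_sym ab.2 cd.2); ring.
Qed.

Lemma quasilin_chasles (ab : X * X) p x u :
  quasilin ab (p, u) = quasilin ab (p, x) + quasilin ab (x, u).
Proof. by rewrite /quasilin /=; ring. Qed.

Lemma quasilin_phi p z q u : quasilin (p, z) (q, u) = phi p z u - phi p z q.
Proof. by rewrite /quasilin /phi /=; ring. Qed.

Lemma phiN p z u : phi p z u = - phi z p u.
Proof. by rewrite /phi; ring. Qed.

Lemma dist_oplus x y lam : hadamard X -> 0 <= lam <= 1 ->
  mdist x (oplus lam x y) = lam * mdist x y.
Proof.
move=> [gX _] lam01; have [g0 _ gd] := geodesicP gX x y.
rewrite -{1}g0 /oplus gd ?lexx ?ler01// sub0r normrN ger0_norm//.
by case/andP: lam01.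
Qed.

Lemma dual_linear_dual (f : X * X -> R) : dual f -> linear_dual X f.
Proof.
move=> df; exists 1%N, (fun=> 1), (fun=> f); split=> //.
by apply/funext => xy; rewrite big_ord1 mul1r.
Qed.

(** By symmetry of [quasilin] and a split of both vectors from [p] at [x], the hypothesis makes each
    class [[t ab]] affine along the geodesic. Finite linear combinations inherit this. *)
Lemma linear_dual_oplus (xl : X * X -> R) p x y lam :
  (forall a b, quasilin (x, oplus lam x y) (a, b) =
               lam * quasilin (x, y) (a, b)) ->
  linear_dual X xl ->
  xl (p, oplus lam x y) = (1 - lam) * xl (p, x) + lam * xl (p, y).
Proof.
move=> H [n [alpha [xs [dxs ->]]]].
rewrite !mulr_sumr -big_split /=; apply: eq_bigr => i _.
have [t [[a b] ->]] := dxs i; rewrite /dual_class.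
rewrite (quasilin_chasles _ p x (oplus _ _ _)) (quasilin_chasles _ p x y).
by rewrite !(quasilinC (a, b) (x, _)) H; ring.
Qed.

End Quasilinearization.

Theorem proposition2p5 (R : realType) (X : completeMetricType R)
    (hX : hadamard X) :
  [<-> flat_hadamard X;
       forall (a b x y : X) (lam : R), 0 <= lam <= 1 ->
         quasilin (x, oplus lam x y) (a, b) = lam * quasilin (x, y) (a, b);
       W_property ([set: X] `*` linear_dual X);
       forall M : set (X * (X * X -> R)),
         M `<=` [set: X] `*` linear_dual X -> W_property M;
       forall p z : X, geo_convex (phi p z);
       forall p z : X, geo_affine (phi p z)].
Proof.
tfae.
(* The correction [lam * (1 - lam) * mdist x y ^+ 2] is the same at [a] and at [b], so it cancels in
   [phi a b]. *)
- move=> [_ flat] a b x y lam lam01; rewrite quasilinC [in RHS]quasilinC.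
  by rewrite !quasilin_phi /phi !flat// (metric_sym a x) (metric_sym b x); ring.
(* Any base point would do: the inequality is an equality. *)
- move=> H; exists point => lam lam01 xl [x0 [_ /= xl_dual]] x1 x2 _ _.
  by rewrite le_eqVlt (linear_dual_oplus xl) ?eqxx// => a b; exact: H.
- move=> [p Wp] M subM; exists p => lam lam01 xl [x Mxl] x1 x2 _ _.
  have [_ /= xl_dual] := subM _ Mxl.
  by apply: Wp => //; [exists x | exists xl | exists xl].
- move=> W p z x y lam lam01.
  have [q /(_ lam lam01 (dual_class 1 (p, z)))] := W _ (@subset_refl _ _).
  have pz_dual : linear_dual X (dual_class 1 (p, z)).
    by apply: dual_linear_dual; exists 1, (p, z).
  (* The class of [(p, z)] also witnesses that [x] and [y] lie in the domain. The constant
     [phi p z q] then cancels, as the weights sum to 1. *)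
  move=> /(_ (ex_intro _ q (conj I pz_dual)) x y).
  move=> /(_ (ex_intro _ _ (conj I pz_dual)) (ex_intro _ _ (conj I pz_dual))).
  rewrite /dual_class !mul1r !quasilin_phi; lra.
- move=> cvx p z x y lam lam01; apply/le_anti; rewrite cvx//=.
  have := cvx z p x y lam lam01; rewrite !(phiN z p); lra.
- move=> aff; split=> // x y z lam lam01.
  have := aff z x x y lam lam01; rewrite /phi dist_oplus// mdistxx => H.
  (* Exposes the left side of [H]; the correction term arises as
     [lam ^+ 2 - lam = - lam * (1 - lam)]. *)
  have -> : mdist z (oplus lam x y) ^+ 2 =
      2 * (2^-1 * (mdist z (oplus lam x y) ^+ 2 - (lam * mdist x y) ^+ 2))
      + (lam * mdist x y) ^+ 2 by field.
  by rewrite H; field.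
Qed.
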